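(* Let $C\in\mathbb{R}^{n\times n}$ be symmetric, let $\mathbf{b}\in\mathbb{R}^n$ have positive entries with $\mathbf{1}_n^\top\mathbf{b}=1$, and let $p_\star$ denote the optimal value of the Max-Cut SDP $$\min\{\mathrm{Tr}[CX]:\ X\in\mathbb{R}^{n\times n}\text{ symmetric},\ \mathrm{diag}(X)=\mathbf{b},\ \mathrm{Tr}[X]=1,\ X\succeq0\}.$$ Let $\kappa=\frac{\max_ib_i}{\min_ib_i}$ and $\beta>0$. Suppose that $\boldsymbol\lambda\in\mathbb{R}^n$ is such that $$X_{\beta,\boldsymbol\lambda}:=\frac{e^{-\beta(C-\mathrm{diag}(\boldsymbol\lambda))}}{\mathrm{Tr}\big[e^{-\beta(C-\mathrm{diag}(\boldsymbol\lambda))}\big]}$$ satisfies $\|\mathrm{diag}(X_{\beta,\boldsymbol\lambda})-\mathbf{b}\|_1\le\delta$. Then $$\big|\mathrm{Tr}[CX_{\beta,\boldsymbol\lambda}]-p_\star\big|\le3\kappa\delta\|C\|_\infty+\beta^{-1}\log n.$$ Moreover, one can efficiently construct $X'$ which is feasible for the Max-Cut SDP above and satisfies $$\mathrm{Tr}[CX']-p_\star\le6\kappa\delta\|C\|_\infty+\beta^{-1}\log n.$$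
   Context: $\|A\|_\infty=\max_j\sum_i|A_{ij}|$ is the induced $\ell^\infty$ operator norm of a symmetric matrix $A$. $\mathrm{diag}$ of a matrix is the vector of its diagonal entries; $\mathrm{diag}$ of a vector is the corresponding diagonal matrix. $\mathbf{1}_n$ is the all-ones vector. *)

(* Defs.v *)
From HB Require Import structures.
From mathcomp Require Import all_boot all_order all_algebra.
From mathcomp Require Import all_classical all_reals all_analysis.

Set Implicit Arguments.
Unset Strict Implicit.
Unset Printing Implicit Defensive.

Import Order.TTheory GRing.Theory Num.Theory.
Import numFieldNormedType.Exports.

Local Open Scope classical_set_scope.
Local Open Scope ring_scope.

Section MaxCutSDP.
Variables (R : realType) (n : nat).
Implicit Types (A C X : 'M[R]_n) (b v lambda : 'rV[R]_n).

Definition norm1 v : R := \sum_(i < n) `|v 0 i|.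

Definition norm_oo A : R := \big[Num.max/0]_(j < n) \sum_(i < n) `|A i j|.

Definition diag_of A : 'rV[R]_n := \row_i A i i.

Definition psd A : Prop :=
  A^T = A /\ forall v : 'rV[R]_n, 0 <= (v *m A *m v^T) 0 0.

(* The series converges for every A; the limit is taken in the library's
   topology on matrices. *)
Definition expmx A : 'M[R]_n :=
  limn (series (fun k : nat => (k`!)%:R^-1 *: A ^+ k)).

(* The neutral elements are harmless for n > 0 and nonnegative b: 0 is below
   every entry, and vmax b is above every entry. *)
Definition vmax b : R := \big[Num.max/0]_(i < n) b 0 i.
Definition vmin b : R := \big[Num.min/vmax b]_(i < n) b 0 i.
Definition kappa b : R := vmax b / vmin b.

Definition maxcut_feasible b X : Prop :=
  [/\ X^T = X, diag_of X = b, \tr X = 1 & psd X].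

(* For b >= 0 with sum 1 the feasible set contains diag_mx b and is compact, so
   this infimum is an attained minimum. *)
Definition maxcut_value C b : R :=
  inf [set \tr (C *m X) | X in [set X | maxcut_feasible b X]].

Definition gibbs C (beta : R) lambda : 'M[R]_n :=
  let E := expmx (- beta *: (C - diag_mx lambda)) in (\tr E)^-1 *: E.

End MaxCutSDP.

(* "Efficiently construct" is rendered in exact real arithmetic: a single
   program, uniform in the dimension n and with polynomially many unit-cost
   real operations.  A program works on real arrays numbered by nat and doubly
   indexed by integer counters; the only iteration is over 0 <= i < n.  Real
   constants are restricted to natural numbers, so that no problem data can be
   hidden in the program. *)
Inductive rexpr : Type :=
| RNat of nat
| RGet of nat & nat & nat (* array number, row counter, column counter *)
| RAdd of rexpr & rexpr
| RSub of rexpr & rexpr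
| RMul of rexpr & rexpr
| RDiv of rexpr & rexpr
| RSqrt of rexpr.

Inductive prog : Type :=
| PSkip
| PSet of nat & nat & nat & rexpr (* same addressing as RGet *)
| PSeq of prog & prog
| PIfLe of rexpr & rexpr & prog & prog
| PIfEq of nat & nat & prog & prog (* compares two counters *)
| PFor of nat & prog.              (* counter ranging over 0, ..., n-1 *)

Section Semantics.
Variables (R : realType) (n : nat).

Definition counters := nat -> nat.
Definition memory := nat -> nat -> nat -> R.

(* Division by 0 and the square root of a negative number return 0. *)
Fixpoint reval (c : counters) (m : memory) (x : rexpr) : R :=
  match x with
  | RNat k => k%:R
  | RGet a i j => m a (c i) (c j)
  | RAdd x y => reval c m x + reval c m y
  | RSub x y => reval c m x - reval c m y
  | RMul x y => reval c m x * reval c m y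
  | RDiv x y => reval c m x / reval c m y
  | RSqrt x => Num.sqrt (reval c m x)
  end.

Fixpoint rcost (x : rexpr) : nat :=
  match x with
  | RNat _ | RGet _ _ _ => 1
  | RAdd x y | RSub x y | RMul x y | RDiv x y => (rcost x + rcost y).+1
  | RSqrt x => (rcost x).+1
  end.

Definition set_counter (c : counters) (i k : nat) : counters :=
  fun i' => if i' == i then k else c i'.

Definition set_memory (m : memory) (a i j : nat) (r : R) : memory :=
  fun a' i' j' => if [&& a' == a, i' == i & j' == j] then r else m a' i' j'.

(* Returns the final memory together with the number of steps. *)
Fixpoint exec (p : prog) (c : counters) (m : memory) : memory * nat :=
  match p with
  | PSkip => (m, 1%N)
  | PSet a i j x =>
      (set_memory m a (c i) (c j) (reval c m x), (rcost x).+1)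
  | PSeq p1 p2 =>
      let s1 := exec p1 c m in
      let s2 := exec p2 c s1.1 in
      (s2.1, (s1.2 + s2.2)%N)
  | PIfLe x y p1 p2 =>
      let s := if reval c m x <= reval c m y
               then exec p1 c m else exec p2 c m in
      (s.1, (rcost x + rcost y + s.2).+1)
  | PIfEq i j p1 p2 =>
      let s := if c i == c j then exec p1 c m else exec p2 c m in
      (s.1, s.2.+1)
  | PFor i p1 =>
      foldl (fun s k =>
               let s' := exec p1 (set_counter c i k) s.1 in
               (s'.1, (s.2 + s'.2).+1))
            (m, 1%N) (iota 0 n)
  end.

Definition entry p q (A : 'M[R]_(p, q)) (i j : nat) : R :=
  match insub i, insub j with
  | Some i', Some j' => A i' j'
  | _, _ => 0
  end.

(* Array 0 holds X, row 0 of array 1 holds b, and all other cells hold 0. *)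
Definition load (X : 'M[R]_n) (b : 'rV[R]_n) : memory :=
  fun a => match a with
           | 0%N => entry X
           | 1%N => entry b
           | _ => fun _ _ => 0
           end.

(* Counters start at 0, so a counter that is never the index of a PFor denotes
   the constant 0. *)
Definition run (p : prog) (X : 'M[R]_n) (b : 'rV[R]_n) : memory * nat :=
  exec p (fun=> 0%N) (load X b).

(* The result is read off array 2. *)
Definition output (p : prog) (X : 'M[R]_n) (b : 'rV[R]_n) : 'M[R]_n :=
  \matrix_(i, j) (run p X b).1 2%N i j.

Definition steps (p : prog) (X : 'M[R]_n) (b : 'rV[R]_n) : nat :=
  (run p X b).2.

End Semantics.

Definition poly_time (R : realType) (p : prog) : Prop :=
  exists K d : nat, forall (n : nat) (X : 'M[R]_n) (b : 'rV[R]_n),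
    (steps p X b <= K * n.+1 ^ d)%N.

(* Main.v *)
(* Given a psd matrix A with diagonal d and a target diagonal t >= 0, put
   s_i = min(1, t_i / d_i) and let A' have diagonal t and off-diagonal entries
   s_i A_ij s_j.  Then A' is diag(s) A diag(s) plus a nonnegative diagonal
   matrix, hence psd.  Since |A_ij| <= (d_i + d_j) / 2 and
     (1 - s_i s_j) d_i = (1 - s_i) d_i + s_i d_i (1 - s_j),
   with s_i d_i = min(d_i, t_i), the entries of A' - A are at most
   kappa (|d_i - t_i| + |d_j - t_j|) as soon as d or t is b, so passing from A
   to A' changes the cost by at most 2 kappa delta ||C||.

   By the Gibbs variational principle X is optimal, up to (log n) / beta, among
   the density matrices with the same diagonal as X: lambda drops out.  Rounding
   a feasible Y to the diagonal of X therefore bounds Tr[CX] above, and rounding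
   X to the diagonal b gives X' and bounds p_* above.

   The Gibbs principle and the exponential only need matrices Q_i >= 0 of trace
   1 with sum 1 and Q_i A = a_i Q_i.  They are the real parts of the spectral
   projections of A seen as a complex matrix. *)
Require Import Defs.
From HB Require Import structures.
From mathcomp Require Import all_boot all_order all_algebra.
From mathcomp Require Import all_classical all_reals all_analysis.
From mathcomp Require Import complex ring lra zify.

Set Implicit Arguments.
Unset Strict Implicit.
Unset Printing Implicit Defensive.

Import Order.TTheory GRing.Theory Num.Theory.
Import numFieldNormedType.Exports.

Local Open Scope ring_scope.

(** * Spectral resolution of a real symmetric matrix *)

Lemma Re_mul (R : rcfType) (x y : R[i]) :
  complex.Re (x * y) = complex.Re x * complex.Re y - complex.Im x * complex.Im y.
Proof. by case: x => a b; case: y. Qed.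

Lemma Im_mul (R : rcfType) (x y : R[i]) :
  complex.Im (x * y) = complex.Re x * complex.Im y + complex.Im x * complex.Re y.
Proof. by case: x => a b; case: y. Qed.

Lemma Re_sum (R : rcfType) (I : finType) (F : I -> R[i]) :
  complex.Re (\sum_i F i) = \sum_i complex.Re (F i).
Proof. by apply: (big_morph (@complex.Re R)) => // -[? ?] [? ?]. Qed.

Lemma Im_sum (R : rcfType) (I : finType) (F : I -> R[i]) :
  complex.Im (\sum_i F i) = \sum_i complex.Im (F i).
Proof. by apply: (big_morph (@complex.Im R)) => // -[? ?] [? ?]. Qed.

(** The complex spectral theorem gives a unitary [P] with [P B = D P], where [B] is [A] over the
    complex numbers. [U] and [V] are the real and imaginary parts of [P]; as [B] and [D] are real,
    the equation splits into one for each. The last two identities are real parts of the two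
    unitarity relations. *)
Lemma symmetric_spectral (R : rcfType) (n : nat) (A : 'M[R]_n) : A^T = A ->
  exists (a : 'rV[R]_n) (U V : 'M[R]_n),
    [/\ U *m A = diag_mx a *m U, V *m A = diag_mx a *m V,
        U^T *m U + V^T *m V = 1%:M
      & forall i, (U *m U^T + V *m V^T) i i = 1].
Proof.
move=> symA; pose B := map_mx (real_complex R) A.
have realB : B \is a mxOver Num.real.
  by apply/mxOverP => i j; rewrite mxE complex_real.
have symB : B \is symmetricmx.
  by apply/eqP; rewrite /= expr0 scale1r map_mx_id // /B map_trmx symA.
have hermB := realsym_hermsym symB realB.
have unitP := spectral_unitarymx B.
have /hermitian_normalmx/orthomx_spectralP := hermB.
have := mxOverP (hermitian_spectral_diag_real hermB).
have Punit := unitarymx_unit unitP.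
move: (unitP) => /unitarymxP.
have := mulVmx Punit; rewrite (invmx_unitary unitP).
move: (spectralmx B) (spectral_diag B) => P d PtP PPt reald.
move=> /(congr1 (mulmx P)); rewrite !mulmxA PPt mul1mx => PB.
have Re_conj (z : R[i]) : complex.Re (Num.conj z) = complex.Re z by case: z.
have Im_conj (z : R[i]) : complex.Im (Num.conj z) = - complex.Im z by case: z.
exists (map_mx (@complex.Re R) d), (map_mx (@complex.Re R) P),
  (map_mx (@complex.Im R) P).
have Im_d i : complex.Im (d 0 i) = 0.
  by move: (reald 0 i); case: (d 0 i) => x y; rewrite complex_real => /eqP.
split.
- apply/matrixP => i j; move/matrixP/(_ i j)/(congr1 (@complex.Re R)): PB.
  rewrite !mul_diag_mx !mxE Re_sum Re_mul Im_d mul0r subr0 => <-.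
  by apply: eq_bigr => k _; rewrite !mxE Re_mul /= mulr0 subr0.
- apply/matrixP => i j; move/matrixP/(_ i j)/(congr1 (@complex.Im R)): PB.
  rewrite !mul_diag_mx !mxE Im_sum Im_mul Im_d mul0r addr0 => <-.
  by apply: eq_bigr => k _; rewrite !mxE Im_mul /= mulr0 add0r.
- apply/matrixP => i j; move/matrixP/(_ i j)/(congr1 (@complex.Re R)): PtP.
  rewrite !mxE Re_sum -big_split /=.
  rewrite (_ : complex.Re (_ *+ _) = (i == j)%:R :> R); last by case: eqP.
  move=> <-; apply: eq_bigr => k _.
  by rewrite !mxE Re_mul Re_conj Im_conj mulNr opprK.
- move=> i; move/matrixP/(_ i i)/(congr1 (@complex.Re R)): PPt.
  rewrite !mxE Re_sum -big_split eqxx /= => <-; apply: eq_bigr => k _.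
  by rewrite !mxE Re_mul Re_conj Im_conj mulrN opprK.
Qed.

Lemma quad_sum_ge0 (R : realType) (n : nat) (u v : 'rV[R]_n) (Y : 'M[R]_n) :
  psd Y -> 0 <= \tr ((u^T *m u + v^T *m v) *m Y).
Proof.
move=> [_ posY]; have tr_quad (w : 'rV[R]_n) : \tr (w^T *m w *m Y) = (w *m Y *m w^T) 0 0.
  by rewrite -mulmxA mxtrace_mulC /mxtrace big_ord1.
by rewrite mulmxDl mxtraceD !tr_quad addr_ge0.
Qed.

(** [Q i] is the real part of the rank-one projection given by the i-th row of the unitary
    eigenvector matrix. It need not be idempotent when eigenvalues repeat. *)
Lemma psd_spectral_resolution (R : realType) (n : nat) (A : 'M[R]_n) : A^T = A ->
  exists (a : 'I_n -> R) (Q : 'I_n -> 'M[R]_n),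
    [/\ forall i, Q i *m A = a i *: Q i, \sum_i Q i = 1%:M,
        forall i, \tr (Q i) = 1, forall i, psd (Q i)
      & forall i Y, psd Y -> 0 <= \tr (Q i *m Y)].
Proof.
move=> /symmetric_spectral[a [U [V [UA VA UV1 norm1]]]].
exists (fun i => a 0 i).
exists (fun i => (row i U)^T *m row i U + (row i V)^T *m row i V).
split=> [i||i|i|i Y].
- rewrite mulmxDl scalerDr -!mulmxA -!row_mul UA VA !row_mul !row_diag_mx.
  by rewrite -!scalemxAl -!rowE -!scalemxAr.
- rewrite -UV1; apply/matrixP => k l; rewrite summxE !mxE -big_split.
  by apply: eq_bigr => i _; rewrite !mxE !big_ord1 !mxE.
- rewrite -(norm1 i) mxtraceD !(mxtrace_mulC _^T) /mxtrace !big_ord1 !mxE.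
  by congr +%R; apply: eq_bigr => k _; rewrite !mxE.
- split=> [|v]; first by rewrite linearD /= !trmx_mul !trmxK.
  (* The form of [Q i] at [v] is the trace of [Q i] against [v^T *m v], so [quad_sum_ge0] applies
     here too. *)
  have posd : psd (v^T *m v).
    split=> [|w]; first by rewrite trmx_mul trmxK.
    rewrite mulmxA -mulmxA [X in _ *m X](_ : _ = (w *m v^T)^T); last first.
      by rewrite trmx_mul trmxK.
    by rewrite mxE big_ord1 [_^T _ _]mxE -expr2 sqr_ge0.
  have := quad_sum_ge0 (row i U) (row i V) posd.
  by rewrite mulmxA mxtrace_mulC mulmxA /mxtrace big_ord1.
- exact: quad_sum_ge0.
Qed.

(** * Matrix exponential and Gibbs variational principle *)

(** Multiplying [\sum_i Q i = 1] on the right by powers of [A] gives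
    [A ^+ k = \sum_i a i ^+ k *: Q i], so the exponential series splits into scalar ones. *)
Lemma expmx_spectral (R : realType) (n : nat) (A : 'M[R]_n) (a : 'I_n -> R)
    (Q : 'I_n -> 'M[R]_n) :
  (forall i, Q i *m A = a i *: Q i) -> \sum_i Q i = 1%:M ->
  expmx A = \sum_i expR (a i) *: Q i.
Proof.
move=> QA Q1; have powA k : A ^+ k = \sum_i a i ^+ k *: Q i.
  elim: k => [|k IHk].
    by rewrite expr0 -[1]/1%:M -Q1; apply: eq_bigr => i _; rewrite scale1r.
  rewrite exprSr IHk -mulmxE mulmx_suml; apply: eq_bigr => i _.
  by rewrite -scalemxAl QA scalerA exprSr.
have serE : series (fun k => (k`!)%:R^-1 *: A ^+ k) =
    fun N => \sum_i series (exp_coeff (a i)) N *: Q i.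
  apply/funext => N; rewrite /series /=.
  under eq_bigr do rewrite powA scaler_sumr.
  rewrite exchange_big; apply: eq_bigr => i _; rewrite scaler_suml.
  by apply: eq_bigr => k _; rewrite scalerA /exp_coeff mulrC.
apply/cvg_lim; first exact: norm_hausdorff.
rewrite serE; apply: cvg_big => [|i _]; first exact: add_continuous.
apply: cvgZr_tmp.
exact: is_cvg_series_exp_coeff.
Qed.

(** Both sides are compared with [ln Z]. Every [a i] is at most [ln Z], hence so is their
    [y]-average; and [ln Z] exceeds the Gibbs average by the entropy of the Gibbs weights, at most
    [ln n]. *)
Lemma gibbs_variational (R : realType) (n : nat) (a y : 'I_n -> R) :
  (forall i, 0 <= y i) -> \sum_i y i = 1 ->
  \sum_i y i * a i
    <= \sum_i (\sum_k expR (a k))^-1 * expR (a i) * a i + ln n%:R.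
Proof.
move=> y_ge0 y1; set Z := \sum_k expR (a k).
have n_gt0 : (0 < n)%N.
  by case: n a y y_ge0 y1 @Z => // a y _ /eqP; rewrite big_ord0 eq_sym oner_eq0.
have leZ i : expR (a i) <= Z.
  by rewrite /Z (bigD1 i) //= lerDl sumr_ge0 // => k _; exact: expR_ge0.
have Z_gt0 : 0 < Z by exact: lt_le_trans (expR_gt0 _) (leZ (Ordinal n_gt0)).
have w1 : \sum_i Z^-1 * expR (a i) = 1 by rewrite -mulr_sumr mulVf ?gt_eqF.
apply: (@le_trans _ _ (ln Z)).
  rewrite -[leRHS]mul1r -y1 mulr_suml; apply: ler_sum => i _.
  by rewrite ler_wpM2l // -[leLHS]expRK ler_ln ?posrE ?expR_gt0.
rewrite -lerBlDl -[ln Z]mul1r -w1 mulr_suml -sumrB.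
have n0 : 0 < n%:R :> R by rewrite ltr0n.
(* [1 + x <= e^x] at [x = ln Z - a i - ln n], weighted by [e^(a i) / Z]. *)
have wle i : Z^-1 * expR (a i) * ln Z - Z^-1 * expR (a i) * a i
    <= n%:R^-1 - Z^-1 * expR (a i) + Z^-1 * expR (a i) * ln n%:R.
  have w_ge0 : 0 <= Z^-1 * expR (a i) by rewrite mulr_ge0 ?expR_ge0 ?invr_ge0 ?ltW.
  have := ler_wpM2l w_ge0 (expR_ge1Dx (ln Z - a i - ln n%:R)).
  rewrite !expRD !expRN !lnK ?posrE // [X in _ <= X -> _](_ : _ = n%:R^-1).
    by move=> le1; lra.
  by field; rewrite !gt_eqF ?expR_gt0.
apply: (le_trans (ler_sum _ (fun i _ => wle i))).
rewrite big_split sumrB -mulr_suml w1 sumr_const card_ord -[_^-1 *+ n]mulr_natl.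
by rewrite mulfV ?gt_eqF // subrr mul1r /= add0r.
Qed.

Lemma gibbs_spectral (R : realType) (n : nat) (C : 'M[R]_n) (beta : R)
    (lambda : 'rV[R]_n) (a : 'I_n -> R) (Q : 'I_n -> 'M[R]_n) :
  (forall i, Q i *m (- beta *: (C - diag_mx lambda)) = a i *: Q i) ->
  \sum_i Q i = 1%:M -> (forall i, \tr (Q i) = 1) ->
  gibbs C beta lambda = \sum_i ((\sum_k expR (a k))^-1 * expR (a i)) *: Q i.
Proof.
move=> QA Q1 trQ; rewrite /gibbs (expmx_spectral QA Q1) scaler_sumr.
rewrite (_ : \tr _ = \sum_k expR (a k)); first by under eq_bigr do rewrite scalerA.
by rewrite raddf_sum; apply: eq_bigr => k _; rewrite /= mxtraceZ trQ mulr1.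
Qed.

Lemma gibbs_density (R : realType) (n : nat) (C : 'M[R]_n) (beta : R)
    (lambda : 'rV[R]_n) : (0 < n)%N -> C^T = C ->
  psd (gibbs C beta lambda) /\ \tr (gibbs C beta lambda) = 1.
Proof.
move=> n_gt0 symC.
have symA : (- beta *: (C - diag_mx lambda))^T = - beta *: (C - diag_mx lambda).
  by rewrite linearZ linearB /= symC tr_diag_mx.
have [a [Q [QA Q1 trQ psdQ _]]] := psd_spectral_resolution symA.
rewrite (gibbs_spectral QA Q1 trQ); set Z := \sum_k expR (a k).
have Z_gt0 : 0 < Z.
  rewrite /Z (bigD1 (Ordinal n_gt0)) //= ltr_pwDl ?expR_gt0 //.
  by rewrite sumr_ge0 // => k _; exact: expR_ge0.
split; last first.
  rewrite raddf_sum -[RHS](mulVf (lt0r_neq0 Z_gt0)) mulr_sumr.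
  by apply: eq_bigr => i _; rewrite /= mxtraceZ trQ mulr1.
split=> [|v].
  by rewrite raddf_sum; apply: eq_bigr => i _; rewrite /= linearZ /= (psdQ i).1.
rewrite mulmx_sumr mulmx_suml summxE sumr_ge0 // => i _.
rewrite -scalemxAr -scalemxAl mxE mulr_ge0 ?(psdQ i).2 //.
by rewrite mulr_ge0 ?expR_ge0 ?invr_ge0 ?ltW.
Qed.

(** The numbers [\tr (Q i *m Y)] are probability weights, and the average of [a] under them is
    [\tr (A *m Y)]: the claim reduces to the scalar inequality. *)
Lemma gibbs_optimality (R : realType) (n : nat) (C Y : 'M[R]_n) (beta : R)
    (lambda : 'rV[R]_n) : C^T = C -> 0 < beta -> psd Y -> \tr Y = 1 ->
  diag_of Y = diag_of (gibbs C beta lambda) ->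
  \tr (C *m gibbs C beta lambda) <= \tr (C *m Y) + beta^-1 * ln n%:R.
Proof.
move=> symC beta_gt0 psdY trY diagY; set X := gibbs C beta lambda.
set H := C - diag_mx lambda; pose A := - beta *: H.
have symA : A^T = A by rewrite /A linearZ linearB /= symC tr_diag_mx.
have [a [Q [QA Q1 trQ psdQ posQ]]] := psd_spectral_resolution symA.
have trA B : \tr (A *m B) = \sum_i \tr (Q i *m B) * a i.
  rewrite -[A]mul1mx -Q1 mulmx_suml mulmx_suml raddf_sum /=.
  by apply: eq_bigr => i _; rewrite QA -scalemxAl mxtraceZ mulrC.
have y1 : \sum_i \tr (Q i *m Y) = 1.
  by rewrite -raddf_sum -mulmx_suml Q1 mul1mx.
have := gibbs_variational a (fun i => posQ i Y psdY) y1; rewrite -trA.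
(* Cyclicity puts each [Q i] to the left of [A], so no product of two of the [Q i] arises. *)
rewrite [X in _ <= X + _](_ : _ = \tr (A *m X)); last first.
  rewrite /X (gibbs_spectral QA Q1 trQ) mxtrace_mulC mulmx_suml raddf_sum /=.
  by apply: eq_bigr => i _; rewrite -scalemxAl QA !mxtraceZ trQ mulr1.
(* The [lambda] term sees only the diagonal, so it cancels between [Y] and [X]. *)
have trD B : diag_of B = diag_of X -> \tr (diag_mx lambda *m B) = \tr (diag_mx lambda *m X).
  move=> /rowP eqB; apply: eq_bigr => i _; rewrite !mul_diag_mx !mxE.
  by have := eqB i; rewrite !mxE => ->.
rewrite /A /H -!scalemxAl !mxtraceZ !mulmxBl !raddfB /= (trD Y diagY) => ineq.
rewrite -(ler_pM2l beta_gt0) mulrDr mulrA mulfV ?gt_eqF // mul1r; lra.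
Qed.

(** * Rounding a psd matrix to a prescribed diagonal *)

Section Rounding.
Variables (R : realType) (n : nat).
Implicit Types (A C : 'M[R]_n) (d t b : 'rV[R]_n).

(** The test makes the value 1 when d_i = 0 <= t_i, where the quotient would be 0 by convention. *)
Definition shrink d t i : R := if d 0 i <= t 0 i then 1 else t 0 i / d 0 i.

Definition rounding A t : 'M[R]_n :=
  let s := shrink (diag_of A) t in
  \matrix_(i, j) if i == j then t 0 i else s i * A i j * s j.

Lemma psd_quad2 A (i j : 'I_n) (x y : R) : psd A ->
  0 <= x ^+ 2 * A i i + x * y * (A i j *+ 2) + y ^+ 2 * A j j.
Proof.
move=> [symA posA].
have Aji : A j i = A i j by rewrite -[in LHS]symA mxE.
pose e (k : 'I_n) : 'rV[R]_n := delta_mx 0 k.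
have quad_e (k l : 'I_n) : (e k *m A *m (e l)^T) 0 0 = A k l.
  by rewrite /e -rowE trmx_delta -colE !mxE.
have := posA (x *: e i + y *: e j).
have -> : (x *: e i + y *: e j)^T = x *: (e i)^T + y *: (e j)^T.
  by rewrite linearD !linearZ.
rewrite !mulmxDl !mulmxDr -!scalemxAl -!scalemxAr.
have addE (M N : 'M[R]_1) : (M + N) 0 0 = M 0 0 + N 0 0 by rewrite mxE.
have scaleE z (M : 'M[R]_1) : (z *: M) 0 0 = z * M 0 0 by rewrite mxE.
by rewrite !addE !scaleE !quad_e Aji; lra.
Qed.

Lemma psd_diag_ge0 A i : psd A -> 0 <= A i i.
Proof.
move=> /psd_quad2-/(_ i i 1 0); rewrite expr1n expr0n /= !mul0r mulr0 mul0r.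
by rewrite !addr0 mul1r.
Qed.

(** The quadratic form is tested on e_i + e_j and e_i - e_j. *)
Lemma psd_offdiag_le A i j : psd A -> `|A i j| *+ 2 <= A i i + A j j.
Proof.
move=> psdA; have := psd_quad2 i j 1 1 psdA; have := psd_quad2 i j 1 (-1) psdA.
by rewrite !expr2; case: (ler0P (A i j)) => _; lra.
Qed.

Lemma shrink_ge0 d t i : 0 <= d 0 i -> 0 <= t 0 i -> 0 <= shrink d t i.
Proof. by move=> d0 t0; rewrite /shrink; case: ifP => // _; rewrite divr_ge0. Qed.

Lemma shrink_le1 d t i : 0 <= t 0 i -> shrink d t i <= 1.
Proof.
move=> t0; rewrite /shrink; case: (leP (d 0 i)) => // lt_td.
by rewrite ler_pdivrMr ?mul1r ?ltW // (le_lt_trans t0).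
Qed.

Lemma shrinkM d t i : 0 <= t 0 i ->
  shrink d t i * d 0 i = Num.min (d 0 i) (t 0 i).
Proof.
move=> t0; rewrite /shrink; case: (leP (d 0 i)) => [_|lt_td]; first by rewrite mul1r.
by rewrite divfK // gt_eqF // (le_lt_trans t0).
Qed.

Lemma trmx_rounding A t : A^T = A -> (rounding A t)^T = rounding A t.
Proof.
move=> symA; apply/matrixP => i j; rewrite !mxE eq_sym; case: eqP => [->//|_].
have -> : A j i = A i j by rewrite -[in LHS]symA mxE.
by ring.
Qed.

Lemma diag_rounding A t : diag_of (rounding A t) = t.
Proof. by apply/rowP => i; rewrite !mxE eqxx. Qed.

Lemma trace_rounding A t : \tr (rounding A t) = \sum_i t 0 i.
Proof. by apply: eq_bigr => i _; rewrite mxE eqxx. Qed.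

Lemma psd_rounding A t : psd A -> (forall i, 0 <= t 0 i) -> psd (rounding A t).
Proof.
move=> psdA t_ge0; split=> [|v]; first exact: trmx_rounding psdA.1.
pose d := diag_of A; have dE i : d 0 i = A i i by rewrite mxE.
pose s := \row_i shrink d t i.
have -> : rounding A t = diag_mx s *m A *m diag_mx s
    + diag_mx (\row_i (t 0 i - s 0 i * A i i * s 0 i)).
  apply/matrixP => i j; rewrite mul_mx_diag mul_diag_mx !mxE.
  by case: eqP => [<-|_] /=; [rewrite mulr1n; ring|rewrite mulr0n addr0].
rewrite mulmxDr mulmxDl mxE addr_ge0 //.
  have := psdA.2 (v *m diag_mx s).
  by rewrite trmx_mul tr_diag_mx !mulmxA.
rewrite mxE sumr_ge0 // => i _; rewrite mul_mx_diag !mxE.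
rewrite mulrAC mulr_ge0 -?expr2 ?sqr_ge0 // subr_ge0.
have d0 : 0 <= d 0 i by rewrite dE psd_diag_ge0.
(* The added diagonal entry is t_i - s_i^2 d_i, where s_i d_i = min(d_i, t_i) <= t_i and the other
   factor s_i is at most 1. *)
rewrite -dE (@le_trans _ _ (Num.min (d 0 i) (t 0 i))) //; last first.
  by rewrite ge_min lexx orbT.
by rewrite -shrinkM // ler_piMr ?shrink_le1 // mulr_ge0 ?shrink_ge0.
Qed.

(** The min-max condition treats both diagonals alike and so serves both roundings: if either
    diagonal is [b], the minimum at i is at most b_i <= kappa b_j, and b_j is at most the maximum at
    j. *)
Lemma rounding_entry A t k i j : psd A -> (forall i, 0 <= t 0 i) -> 1 <= k ->
  (forall i j, Num.min (A i i) (t 0 i) <= k * Num.max (A j j) (t 0 j)) ->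
  `|rounding A t i j - A i j| <= k * (`|A i i - t 0 i| + `|A j j - t 0 j|).
Proof.
move=> psdA t_ge0 k_ge1 kP.
pose d := diag_of A; have dE l : d 0 l = A l l by rewrite mxE.
have d_ge0 l : 0 <= d 0 l by rewrite dE psd_diag_ge0.
have k_ge0 : 0 <= k by rewrite (le_trans ler01).
rewrite mxE; case: eqP => [<-|_].
  rewrite distrC (le_trans (_ : _ <= k * `|A i i - t 0 i|)) ?ler_peMl //.
  by rewrite ler_wpM2l // lerDl.
pose s := shrink d t; rewrite -/d -/s.
have s_le1 l : s l <= 1 by exact: shrink_le1.
have s_ge0 l : 0 <= s l by exact: shrink_ge0.
have drop l : (1 - s l) * d 0 l <= `|d 0 l - t 0 l|.
  rewrite mulrBl mul1r shrinkM //.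
  by case: (leP (d 0 l)) => _; [rewrite subrr|exact: ler_norm].
(* If t_m < d_m, then 1 - s_m = (d_m - t_m) / d_m and the maximum in [kP] is d_m; otherwise 1 - s_m
   = 0. *)
have cross l m : s l * d 0 l * (1 - s m) <= k * `|d 0 m - t 0 m|.
  have := kP l m; rewrite -!dE /s shrinkM // [shrink d t m]/shrink.
  case: (leP (d 0 m) (t 0 m)) => [_ _|lt_td le_k].
    by rewrite subrr mulr0 mulr_ge0.
  have dm_gt0 : 0 < d 0 m by rewrite (le_lt_trans (t_ge0 m)).
  rewrite gtr0_norm ?subr_gt0 // (_ : 1 - _ = (d 0 m - t 0 m) / d 0 m); last first.
    by rewrite mulrBl divff ?gt_eqF.
  by rewrite mulrA ler_pdivrMr // mulrAC ler_pM2r ?subr_gt0.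
have half l m : (1 - s l * s m) * d 0 l <= k * (`|d 0 l - t 0 l| + `|d 0 m - t 0 m|).
  have := cross l m; have := drop l.
  have : `|d 0 l - t 0 l| <= k * `|d 0 l - t 0 l| by rewrite ler_peMl.
  lra.
have ss_le1 : s i * s j <= 1 by rewrite mulr_ile1.
rewrite (_ : _ - _ = - ((1 - s i * s j) * A i j)); last by ring.
rewrite normrN normrM ger0_norm ?subr_ge0 //.
have ss_ge0 : 0 <= 1 - s i * s j by rewrite subr_ge0.
(* The sum of [half i j] and [half j i] bounds twice the wanted quantity. *)
have := ler_wpM2l ss_ge0 (psd_offdiag_le i j psdA).
have := half i j; have := half j i; rewrite -!dE; lra.
Qed.

(** The entrywise bound leaves two sums of [|C i j|], weighted by [e j] and by [e i]. Column sums
    bound the first, and symmetry of [C] turns the second into it; hence the factor 2. *)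
Lemma rounding_cost A C t k delta : psd A -> C^T = C ->
  (forall i, 0 <= t 0 i) -> 1 <= k ->
  (forall i j, Num.min (A i i) (t 0 i) <= k * Num.max (A j j) (t 0 j)) ->
  norm1 (diag_of A - t) <= delta ->
  `|\tr (C *m rounding A t) - \tr (C *m A)| <= 2%:R * k * delta * norm_oo C.
Proof.
move=> psdA symC t_ge0 k_ge1 kP le_delta.
have k_ge0 : 0 <= k by rewrite (le_trans ler01).
pose e i := `|A i i - t 0 i|.
have colC j : \sum_i `|C i j| <= norm_oo C.
  by rewrite /norm_oo; apply: (le_bigmax _ (fun j => \sum_i `|C i j|)).
have normC_ge0 : 0 <= norm_oo C.
  exact: bigmax_ge_id.
have sum_e : \sum_j \sum_i `|C i j| * e j <= norm_oo C * delta.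
  apply: (@le_trans _ _ (\sum_j norm_oo C * e j)).
    by apply: ler_sum => j _; rewrite -mulr_suml ler_wpM2r // /e.
  rewrite -mulr_sumr ler_wpM2l // (le_trans _ le_delta) //.
  by rewrite /norm1 le_eqVlt; apply/orP; left; apply/eqP/eq_bigr => i _; rewrite !mxE.
have symC_sum : \sum_j \sum_i `|C i j| * e i <= norm_oo C * delta.
  rewrite exchange_big /= (le_trans _ sum_e) // le_eqVlt; apply/orP; left.
  apply/eqP/eq_bigr => j _; apply: eq_bigr => i _.
  by rewrite -[in LHS]symC mxE.
have -> : \tr (C *m rounding A t) - \tr (C *m A) = \tr (C *m (rounding A t - A)).
  by rewrite mulmxBr raddfB.
apply: (@le_trans _ _ (\sum_j \sum_i `|C i j| * (k * (e i + e j)))).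
  rewrite exchange_big /mxtrace /= (le_trans (ler_norm_sum _ _ _)) //.
  apply: ler_sum => i _.
  rewrite mxE (le_trans (ler_norm_sum _ _ _)) //; apply: ler_sum => j _.
  rewrite normrM ler_wpM2l // [X in `|X|]mxE [X in _ + X]mxE [e i + _]addrC.
  exact: rounding_entry.
rewrite (_ : \sum_j _ = k * (\sum_j \sum_i `|C i j| * e i + \sum_j \sum_i `|C i j| * e j)).
  have := ler_wpM2l k_ge0 (lerD symC_sum sum_e); lra.
rewrite -big_split /= mulr_sumr; apply: eq_bigr => j _.
rewrite -big_split /= mulr_sumr; apply: eq_bigr => i _; ring.
Qed.

End Rounding.

(** * The rounding program: correctness and cost *)

(** Loop invariant rule for the fold that interprets [PFor]. *)
Lemma foldl_iota_ind (S : Type) (P : nat -> S -> Prop) (f : S -> nat -> S)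
    (s : S) (n : nat) :
  P 0%N s -> (forall k s', (k < n)%N -> P k s' -> P k.+1 (f s' k)) ->
  P n (foldl f s (iota 0 n)).
Proof.
move=> P0 PS; suff: forall k, (k <= n)%N -> P k (foldl f s (iota 0 k)) by exact.
elim=> [//|k IHk] lt_kn.
by rewrite -addn1 iotaD foldl_cat add0n addn1; apply: PS => //; apply/IHk/ltnW.
Qed.

Lemma entry_ord (R : realType) (p q : nat) (A : 'M[R]_(p, q)) (i : 'I_p) (j : 'I_q) :
  entry A i j = A i j.
Proof. by rewrite /entry !valK. Qed.

(* Counters 0 and 1 hold the row and the column; counter 2 is the constant 0. *)
Definition shrink_prog (l : nat) : rexpr :=
  RDiv (RGet 1 2 l) (RGet 0 l l).

Definition if_unshrunk (l : nat) (p1 p2 : prog) : prog :=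
  PIfLe (RGet 0 l l) (RGet 1 2 l) p1 p2.

(** Expressions have no conditional, so the two cases of [shrink] at the row and at the column
    become four assignments. *)
Definition rounding_entry_prog : prog :=
  let x := RGet 0 0 1 in
  PIfEq 0 1 (PSet 2 0 1 (RGet 1 2 0))
    (if_unshrunk 0
      (if_unshrunk 1 (PSet 2 0 1 x) (PSet 2 0 1 (RMul x (shrink_prog 1))))
      (if_unshrunk 1 (PSet 2 0 1 (RMul (shrink_prog 0) x))
        (PSet 2 0 1 (RMul (RMul (shrink_prog 0) x) (shrink_prog 1))))).

Definition rounding_prog : prog := PFor 0 (PFor 1 rounding_entry_prog).

Section Correctness.
Variables (R : realType) (n : nat).
Implicit Types (X : 'M[R]_n) (b : 'rV[R]_n) (m : memory R) (c : counters).

Lemma exec_for i (p : prog) c m : exec n (PFor i p) c m =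
  foldl (fun s k => let s' := exec n p (set_counter c i k) s.1 in
                    (s'.1, (s.2 + s'.2).+1)) (m, 1%N) (iota 0 n).
Proof. by []. Qed.

Lemma exec_rounding_entry X b c m (i j : 'I_n) :
  (forall i j, m 0%N i j = load X b 0 i j) ->
  (forall i j, m 1%N i j = load X b 1 i j) ->
  c 0%N = i -> c 1%N = j -> c 2%N = 0%N ->
  (exec n rounding_entry_prog c m).1 = set_memory m 2 i j (rounding X b i j).
Proof.
move=> m0 m1 c0 c1 c2.
have b0 (l : 'I_n) : entry b 0 l = b 0 l by exact: (entry_ord b 0).
rewrite /= !c0 !c1 !c2 !m0 !m1 /= !entry_ord !b0 mxE /shrink ![diag_of _ 0 _]mxE val_eqE.
by case: eqP => //= _; case: ifP => _; case: ifP => _ /=;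
  rewrite ?c0 ?c1 ?c2 ?m0 ?m1 /= ?entry_ord ?b0 ?mul1r ?mulr1.
Qed.

(** The longest path takes 17 steps: 1 for the counter test, 3 for each comparison, 10 for the last
    assignment. *)
Lemma cost_rounding_entry c m : ((exec n rounding_entry_prog c m).2 <= 20)%N.
Proof. by rewrite /=; case: ifP => // _; case: ifP => _; case: ifP. Qed.

Lemma cost_for i (p : prog) (K : nat) c m :
  (forall c m, ((exec n p c m).2 <= K)%N) ->
  ((exec n (PFor i p) c m).2 <= (n * K.+1).+1)%N.
Proof.
move=> leK; rewrite exec_for; set f := (f in foldl f).
apply: (@foldl_iota_ind _ (fun k s => (s.2 <= (k * K.+1).+1)%N)) => // k s _ le_s.
by rewrite /= mulSn ltnS addnC addSn -addnS leq_add.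
Qed.

Lemma exec_rounding_row X b c m (i : 'I_n) :
  (forall i j, m 0%N i j = load X b 0 i j) ->
  (forall i j, m 1%N i j = load X b 1 i j) ->
  c 0%N = i -> c 2%N = 0%N ->
  forall a i' j', (exec n (PFor 1 rounding_entry_prog) c m).1 a i' j' =
    if [&& a == 2%N, i' == i & (j' < n)%N] then entry (rounding X b) i' j'
    else m a i' j'.
Proof.
move=> m0 m1 c0 c2; rewrite exec_for; set f := (f in foldl f).
(* The invariant also leaves all other cells unchanged, so arrays 0 and 1 still hold the input for
   the next entry. *)
pose P k (s : memory R * nat) := forall a i' j', s.1 a i' j' =
  if [&& a == 2%N, i' == i & (j' < k)%N] then entry (rounding X b) i' j'
  else m a i' j'.
apply: (@foldl_iota_ind _ P) => [|k s lt_kn Ps] a i' j'; first by rewrite ltn0 !andbF.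
have -> : (f s k).1 = (exec n rounding_entry_prog (set_counter c 1 k) s.1).1 by [].
rewrite (@exec_rounding_entry X b _ _ i (Ordinal lt_kn)) //=.
- rewrite /set_memory Ps ltnS [(j' <= k)%N]leq_eqVlt; case: (a == _) => //=.
  case: eqP => //= ->; case: eqP => //= ->.
  exact: esym (entry_ord _ _ (Ordinal lt_kn)).
- by move=> i1 j1; rewrite Ps m0.
- by move=> i1 j1; rewrite Ps m1.
Qed.

Lemma output_rounding_prog X b : output rounding_prog X b = rounding X b.
Proof.
apply/matrixP => i j; rewrite mxE /run exec_for; set f := (f in foldl f).
pose P k (s : memory R * nat) := forall a i' j', s.1 a i' j' =
  if [&& a == 2%N, (i' < k)%N & (j' < n)%N] then entry (rounding X b) i' j'
  else load X b a i' j'.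
suff /(_ 2%N i j) -> : P n (foldl f (load X b, 1%N) (iota 0 n)).
  by rewrite !ltn_ord entry_ord.
apply: (@foldl_iota_ind _ P) => [|k s lt_kn Ps] a i' j'; first by rewrite ltn0 !andbF.
have -> : (f s k).1 =
    (exec n (PFor 1 rounding_entry_prog) (set_counter (fun=> 0%N) 0 k) s.1).1 by [].
rewrite (@exec_rounding_row X b _ _ (Ordinal lt_kn)) //=.
- rewrite Ps ltnS [(i' <= k)%N]leq_eqVlt; case: (a == _) => //=.
  by case: eqP => //= ->; case: (j' < n)%N; rewrite ?andbF.
Qed.

End Correctness.

Lemma poly_time_rounding_prog (R : realType) : poly_time R rounding_prog.
Proof.
(* The nested loops take at most 21 n^2 + 2 n + 1 steps. *)
exists 24%N, 2%N => n X b.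
have := @cost_for R n 0 (PFor 1 rounding_entry_prog) _ (fun=> 0%N) (load X b)
  (fun c m => cost_for 1 c m (@cost_rounding_entry R n)).
rewrite -/rounding_prog => /leq_trans; apply; nia.
Qed.

(** * Comparison with the SDP optimum *)

Lemma kappaP (R : realType) (n : nat) (b : 'rV[R]_n) (i j : 'I_n) :
  (forall i, 0 < b 0 i) -> b 0 i <= kappa b * b 0 j.
Proof.
move=> b_gt0.
have le_max k : b 0 k <= vmax b by exact: (le_bigmax _ (fun k => b 0 k)).
have min_le k : vmin b <= b 0 k by exact: (@bigmin_le _ _ _ _ k (fun k => b 0 k)).
(* The default value [vmax b] of the minimum must be positive as well; the index [i] ensures it. *)
have min_gt0 : 0 < vmin b.
  by apply/bigmin_gtP; split=> //; exact: lt_le_trans (b_gt0 i) (le_max i).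
rewrite /kappa mulrAC ler_pdivlMr // ler_pM //; exact: ltW.
Qed.

Lemma maxcut_feasible_rounding (R : realType) (n : nat) (A : 'M[R]_n) (b : 'rV[R]_n) :
  psd A -> (forall i, 0 < b 0 i) -> \sum_i b 0 i = 1 ->
  maxcut_feasible b (rounding A b).
Proof.
move=> psdA b_gt0 b1; split.
- exact: trmx_rounding psdA.1.
- exact: diag_rounding.
- by rewrite trace_rounding.
- by apply: psd_rounding => // i; exact: ltW.
Qed.

Theorem theorem28 (R : realType) :
  exists construct : prog,
    poly_time R construct /\
    forall (n : nat) (C : 'M[R]_n) (b lambda : 'rV[R]_n) (beta delta : R),
      C^T = C ->
      (forall i, 0 < b 0 i) ->
      \sum_(i < n) b 0 i = 1 ->
      0 < beta ->
      let X := gibbs C beta lambda in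
      norm1 (diag_of X - b) <= delta ->
      `|\tr (C *m X) - maxcut_value C b|
        <= 3%:R * kappa b * delta * norm_oo C + beta^-1 * ln n%:R
      /\
      let X' := output construct X b in
      maxcut_feasible b X' /\
      \tr (C *m X') - maxcut_value C b
        <= 6%:R * kappa b * delta * norm_oo C + beta^-1 * ln n%:R.
Proof.
exists rounding_prog; split; first exact: poly_time_rounding_prog.
move=> n C b lambda beta delta symC b_gt0 b1 beta_gt0 X le_delta /=.
rewrite output_rounding_prog.
have n_gt0 : (0 < n)%N.
  case: n C b lambda symC b_gt0 b1 @X le_delta => // C b lambda _ _ /eqP.
  by rewrite big_ord0 eq_sym oner_eq0.
pose i0 := Ordinal n_gt0; have b_ge0 i : 0 <= b 0 i by exact: ltW.
have [psdX trX] : psd X /\ \tr X = 1 by exact: gibbs_density.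
have feasX' := maxcut_feasible_rounding psdX b_gt0 b1.
have k_ge1 : 1 <= kappa b by rewrite -(ler_pM2r (b_gt0 i0)) mul1r kappaP.
have k_ge0 : 0 <= kappa b by rewrite (le_trans ler01).
have costX' := rounding_cost psdX symC b_ge0 k_ge1.
have {}costX' : `|\tr (C *m rounding X b) - \tr (C *m X)|
    <= 2%:R * kappa b * delta * norm_oo C.
  apply: costX' => // i j; rewrite (@le_trans _ _ (b 0 i)) ?ge_min ?lexx ?orbT //.
  by rewrite (le_trans (kappaP i j b_gt0)) // ler_wpM2l // le_max lexx orbT.
have lower : lbound [set \tr (C *m Y) | Y in [set Y | maxcut_feasible b Y]]
    (\tr (C *m X) - 2%:R * kappa b * delta * norm_oo C - beta^-1 * ln n%:R).
  move=> _ [Y [symY diagY trY psdY] <-].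
  have diagX_ge0 i : 0 <= diag_of X 0 i by rewrite mxE psd_diag_ge0.
  have YE i : Y i i = b 0 i by rewrite -diagY mxE.
  have costY : `|\tr (C *m rounding Y (diag_of X)) - \tr (C *m Y)|
      <= 2%:R * kappa b * delta * norm_oo C.
    apply: rounding_cost => // [i j|]; last first.
      rewrite diagY (le_trans _ le_delta) // le_eqVlt; apply/orP; left.
      by apply/eqP/eq_bigr => i _; rewrite !mxE distrC.
    rewrite !YE (@le_trans _ _ (b 0 i)) ?ge_min ?lexx //.
    by rewrite (le_trans (kappaP i j b_gt0)) // ler_wpM2l // le_max lexx.
  have tr1 : \tr (rounding Y (diag_of X)) = 1.
    by rewrite trace_rounding -trX; apply: eq_bigr => i _; rewrite mxE.
  have := gibbs_optimality symC beta_gt0 (psd_rounding psdY diagX_ge0) tr1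
    (diag_rounding _ _).
  rewrite -/X; move: costY; rewrite ler_norml => /andP[_]; lra.
(* The infimum lies below the members of a set bounded below; [lower] supplies such a bound. *)
have p_le : maxcut_value C b <= \tr (C *m rounding X b).
  apply: ge_inf; first by eexists; exact: lower.
  by exists (rounding X b).
(* [rounding X b] shows that the set of feasible costs is nonempty. *)
have le_p := lb_le_inf (ex_intro _ _ (ex_intro2 _ _ _ feasX' erefl)) lower.
(* The bounds obtained have constants 2 and 4; nonnegativity of the error terms relaxes them to 3
   and 6. *)
have err_ge0 : 0 <= kappa b * delta * norm_oo C.
  have norm_ge0 : 0 <= norm_oo C by exact: bigmax_ge_id.
  have delta_ge0 : 0 <= delta by apply: le_trans le_delta; exact: sumr_ge0.
  by rewrite mulr_ge0 // mulr_ge0.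
have log_ge0 : 0 <= beta^-1 * ln n%:R :> R.
  by rewrite mulr_ge0 ?invr_ge0 ?ln_ge0 ?ler1n // ltW.
move: costX' le_p; rewrite -/(maxcut_value C b) ler_norml => /andP[le1 le2] le3.
split; [rewrite ler_norml; lra|split=> //; lra].
Qed.
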